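(* Let $\mathfrak{C}$ be any category. Then $\mathfrak{C}\text{-}\mathbf{data}$ has lax colimits indexed by finite posets, and they are described by the cylinder functor $\mathrm{Cyl}\colon(\mathfrak{C}\text{-}\mathbf{data})^{\mathrm{op}}\text{-}\mathbf{data}\to\mathfrak{C}\text{-}\mathbf{data}$. Precisely: for every $\mathcal{X}\in(\mathfrak{C}\text{-}\mathbf{data})^{\mathrm{op}}\text{-}\mathbf{data}$ and every $Y\in\mathfrak{C}\text{-}\mathbf{data}$ there is an isomorphism of categories $$\mathrm{Hom}_{\mathfrak{C}\text{-}\mathbf{data}}(\mathrm{Cyl}(\mathcal{X}),Y)\;\overset{\sim}{\longrightarrow}\;\mathrm{Hom}_{(\mathfrak{C}\text{-}\mathbf{data})^{\mathrm{op}}\text{-}\mathbf{data}^{\mathrm{Lax}}}(\mathcal{X},Y),$$ functorial in $\mathcal{X}$ and $Y$. In other words, $\mathrm{Cyl}$ coincides up to natural isomorphism with the lax sections functor (lax colimit functor) of the inclusion sending $Y\in\mathfrak{C}\text{-}\mathbf{data}$ to the one-point datum with value $Y$.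
   Context: **$\mathfrak{C}$-data.** An object of $\mathfrak{C}\text{-}\mathbf{data}$ is a pair of a finite poset $|\mathcal{F}|$ and a functor $\mathcal{F}\colon|\mathcal{F}|\to\mathfrak{C}$, with restriction morphisms $\mathcal{F}_{xy}\colon\mathcal{F}(x)\to\mathcal{F}(y)$ for $x\le y$. A morphism $f\colon\mathcal{F}\to\mathcal{G}$ is a monotone map $|f|\colon|\mathcal{F}|\to|\mathcal{G}|$ (also written $f$) with a natural transformation $f^\sharp\colon\mathcal{G}\circ|f|\to\mathcal{F}$, i.e. morphisms $f^\sharp_x\colon\mathcal{G}(f(x))\to\mathcal{F}(x)$ compatible with restrictions. Composition is $(g\circ f)^\sharp_x=f^\sharp_x\circ g^\sharp_{f(x)}$. **2-morphisms.** For $f,g\colon\mathcal{F}\to\mathcal{G}$ there is a unique 2-morphism $f\to g$, written $f\le g$, exactly when $|f|\le|g|$ pointwise and $g^\sharp_x\circ\mathcal{G}_{f(x)g(x)}=f^\sharp_x$ for all $x\in|\mathcal{F}|$. Thus $\mathrm{Hom}_{\mathfrak{C}\text{-}\mathbf{data}}(\mathcal{F},\mathcal{G})$ is a poset, seen as a category. **$(\mathfrak{C}\text{-}\mathbf{data})^{\mathrm{op}}$-data.** An object $\mathcal{X}$ is a finite poset $P=|\mathcal{X}|$ and a functor $\mathcal{X}\colon P\to(\mathfrak{C}\text{-}\mathbf{data})^{\mathrm{op}}$, i.e. $\mathfrak{C}$-data $\mathcal{X}(p)$ and morphisms $\mathcal{X}_{pq}\colon\mathcal{X}(q)\to\mathcal{X}(p)$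 in $\mathfrak{C}\text{-}\mathbf{data}$ for $p\le q$, functorially. A morphism $\mathcal{X}\to\mathcal{X}'$ is a monotone map $\varphi\colon|\mathcal{X}|\to|\mathcal{X}'|$ with morphisms $\varphi_p\colon\mathcal{X}(p)\to\mathcal{X}'(\varphi(p))$ in $\mathfrak{C}\text{-}\mathbf{data}$ such that $\varphi_p\circ\mathcal{X}_{pq}=\mathcal{X}'_{\varphi(p)\varphi(q)}\circ\varphi_q$ for $p\le q$. **Cylinder.** $\mathrm{Cyl}(\mathcal{X})$ is the $\mathfrak{C}$-datum with underlying set $\coprod_{p\in P}|\mathcal{X}(p)|$, ordered by: $x_p\le y_q$ (with $x_p\in|\mathcal{X}(p)|$, $y_q\in|\mathcal{X}(q)|$) if and only if $p\le q$ and $x_p\le\mathcal{X}_{pq}(y_q)$ in $|\mathcal{X}(p)|$. Its functor is $\mathrm{Cyl}(\mathcal{X})(x_p)=\mathcal{X}(p)(x_p)$, and for $x_p\le y_q$ the restriction morphism is the composite $$\mathcal{X}(p)(x_p)\to\mathcal{X}(p)(\mathcal{X}_{pq}(y_q))\xrightarrow{(\mathcal{X}_{pq})^\sharp_{y_q}}\mathcal{X}(q)(y_q)$$ whose first map is the restriction of $\mathcal{X}(p)$. On morphisms of data, $\mathrm{Cyl}(\varphi)$ is given by the $\varphi_p$ on each piece. **Lax morphisms to a constant object.** $Y\in\mathfrak{C}\text{-}\mathbf{data}$ is regarded as the datum with one-point underlying poset and value $Y$. The category $\mathrm{Hom}_{(\mathfrak{C}\text{-}\mathbf{data})^{\mathrm{op}}\text{-}\mathbf{data}^{\mathrm{Lax}}}(\mathcal{X},Y)$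 is the poset of lax natural transformations: families $\{f_p\colon\mathcal{X}(p)\to Y\}_{p\in P}$ of morphisms of $\mathfrak{C}\text{-}\mathbf{data}$ with $f_p\circ\mathcal{X}_{pq}\le f_q$ for all $p\le q$, ordered by $\{f_p\}\le\{g_p\}$ if and only if $f_p\le g_p$ for all $p$. *)

(* Defs.v *)
From HB Require Import structures.
From mathcomp Require Import all_boot all_order.
From Stdlib Require Import FunctionalExtensionality ProofIrrelevance.

Set Implicit Arguments.
Unset Strict Implicit.
Unset Printing Implicit Defensive.
Import Order.TTheory.
Local Open Scope order_scope.

Declare Scope cat_scope.
Delimit Scope cat_scope with cat.

Record category := Category {
  obj :> Type;
  hom : obj -> obj -> Type;
  idm : forall a, hom a a;
  cmp : forall a b c, hom b c -> hom a b -> hom a c;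
  cmp1m : forall a b (f : hom a b), cmp (idm b) f = f;
  cmpm1 : forall a b (f : hom a b), cmp f (idm a) = f;
  cmpA : forall a b c d (h : hom c d) (g : hom b c) (f : hom a b),
    cmp h (cmp g f) = cmp (cmp h g) f
}.
Arguments hom {c} a b : rename.
Arguments idm {c} a : rename.
Arguments cmp {c} {a b c0} g f : rename.
Notation "g ∘ f" := (cmp g f) (at level 40, left associativity) : cat_scope.
Local Open Scope cat_scope.

Definition op (C : category) : category :=
  @Category C (fun a b => @hom C b a) (@idm C)
    (fun a b c (g : @hom C c b) (f : @hom C b a) => f ∘ g)
    (fun a b f => cmpm1 f) (fun a b f => cmp1m f)
    (fun a b c d h g f => esym (cmpA f g h)).

Record functor (A B : category) := Functor {
  fobj :> A -> B;
  fmap : forall a a' : A, hom a a' -> hom (fobj a) (fobj a');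
  fmap1 : forall a : A, fmap (idm a) = idm (fobj a);
  fmapM : forall (a a' a'' : A) (g : hom a' a'') (f : hom a a'),
    fmap (g ∘ f) = fmap g ∘ fmap f
}.
Arguments fmap {A B} F {a a'} f : rename.

Definition functor_id (A : category) : functor A A :=
  @Functor A A (fun a => a) (fun _ _ f => f)
    (fun _ => erefl) (fun _ _ _ _ _ => erefl).

Definition functor_comp (A B D : category) (G : functor B D) (F : functor A B) :
  functor A D :=
  @Functor A D (fun a => G (F a)) (fun _ _ f => fmap G (fmap F f))
    (fun a => etrans (f_equal (fmap G) (fmap1 F a)) (fmap1 G (F a)))
    (fun _ _ _ g f => etrans (f_equal (fmap G) (fmapM F g f))
                             (fmapM G (fmap F g) (fmap F f))).

Record nat_trans (A B : category) (F G : functor A B) := NatTrans {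
  nt_app :> forall a : A, hom (F a) (G a);
  nt_nat : forall (a a' : A) (f : hom a a'),
    fmap G f ∘ nt_app a = nt_app a' ∘ fmap F f
}.

Definition is_iso (A : category) (a b : A) (f : hom a b) : Prop :=
  exists g : hom b a, g ∘ f = idm a /\ f ∘ g = idm b.

Definition nat_isomorphic (A B : category) (F G : functor A B) : Prop :=
  exists t : nat_trans F G, forall a : A, is_iso (t a).

Record cat_iso (A B : category) := CatIso {
  iso_fun :> functor A B;
  iso_inv : functor B A;
  iso_funK : functor_comp iso_inv iso_fun = functor_id A;
  iso_invK : functor_comp iso_fun iso_inv = functor_id B
}.

(* Possibly infinite posets: the hom-sets of C-data are ordered by a
   Prop-valued relation. *)
Record poset := Poset {
  pcar :> Type;
  ple : pcar -> pcar -> Prop;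
  ple_refl : forall x, ple x x;
  ple_trans : forall x y z, ple x y -> ple y z -> ple x z;
  ple_anti : forall x y, ple x y -> ple y x -> x = y
}.

Definition poset_cat (P : poset) : category :=
  @Category P (@ple P) (@ple_refl P)
    (fun x y z (h : ple y z) (k : ple x y) => ple_trans k h)
    (fun x y f => proof_irrelevance _ _ _)
    (fun x y f => proof_irrelevance _ _ _)
    (fun x y z t h g f => proof_irrelevance _ _ _).

Definition poset_functor (P Q : poset) (f : P -> Q)
    (fM : forall x y, ple x y -> ple (f x) (f y)) :
  functor (poset_cat P) (poset_cat Q) :=
  @Functor (poset_cat P) (poset_cat Q) f fM
    (fun x => proof_irrelevance (ple (f x) (f x)) _ _)
    (fun x _ z _ _ => proof_irrelevance (ple (f x) (f z)) _ _).

(* MathComp's order displays only select notations, so fixing one is no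
   restriction on the finite posets considered. *)
Fact data_display : Order.disp_t. Proof. exact: Order.Disp tt tt. Qed.
Notation finposet := (finPOrderType data_display).

Definition finposet_cat (P : finposet) : category :=
  @Category P (fun x y : P => x <= y) (fun x : P => lexx x)
    (fun x y z (h : y <= z) (k : x <= y) => le_trans k h)
    (fun x y f => bool_irrelevance _ _)
    (fun x y f => bool_irrelevance _ _)
    (fun x y z t h g f => bool_irrelevance _ _).

Section Data.
Variable C : category.

Record datum := Datum {
  dposet : finposet;
  dfun : functor (finposet_cat dposet) C
}.

Definition val_at (F : datum) (x : dposet F) : C := dfun F x.
Definition res (F : datum) (x y : dposet F) (h : x <= y) :
  hom (val_at x) (val_at y) := @fmap _ _ (dfun F) x y h.

Lemma res1 (F : datum) (x : dposet F) (h : x <= x) : res h = idm (val_at x).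
Proof. by rewrite (bool_irrelevance h (lexx x)); exact: (fmap1 (dfun F) x). Qed.

Lemma resM (F : datum) (x y z : dposet F) (h : x <= y) (k : y <= z)
  (l : x <= z) : res k ∘ res h = res l.
Proof.
rewrite (bool_irrelevance l (le_trans h k)).
exact: esym (@fmapM _ _ (dfun F) x y z k h).
Qed.

Record datum_mor (F G : datum) := DatumMor {
  dmap : dposet F -> dposet G;
  dmapM : forall x y, x <= y -> dmap x <= dmap y;
  sharp : forall x, hom (val_at (dmap x)) (val_at x);
  sharpM : forall x y (h : x <= y),
    res h ∘ sharp x = sharp y ∘ res (dmapM h)
}.

Definition mor_le (F G : datum) (f g : datum_mor F G) : Prop :=
  exists h : forall x, dmap f x <= dmap g x,
    forall x, sharp g x ∘ res (h x) = sharp f x.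

Lemma mor_le_refl F G (f : datum_mor F G) : mor_le f f.
Proof. by exists (fun x => lexx _) => x; rewrite res1 cmpm1. Qed.

Lemma mor_le_trans F G (f g h : datum_mor F G) :
  mor_le f g -> mor_le g h -> mor_le f h.
Proof.
move=> [a fa] [b gb]; exists (fun x => le_trans (a x) (b x)) => x.
by rewrite -fa -gb -cmpA (resM _ _ (le_trans (a x) (b x))).
Qed.

Lemma mor_eq F G (f g : datum_mor F G) :
  dmap f =1 dmap g -> mor_le f g -> f = g.
Proof.
case: f g => [f fM fs fsM] [g gM gs gsM] /= /functional_extensionality fg.
case: g / fg gM gs gsM => gM gs gsM [/= h hs].
have E : gs = fs.
  by apply: functional_extensionality_dep => x; rewrite -hs res1 cmpm1.
case: fs / E fsM hs => fsM _.
have E : gM = fM by exact: proof_irrelevance.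
by case: fM / E fsM => fsM; congr DatumMor; exact: proof_irrelevance.
Qed.

Lemma mor_le_anti F G (f g : datum_mor F G) :
  mor_le f g -> mor_le g f -> f = g.
Proof.
move=> fg gf; apply: mor_eq => // x.
by case: fg gf => a _ [b _]; apply: le_anti; rewrite a b.
Qed.

Definition mor_id F : datum_mor F F.
Proof.
refine (@DatumMor F F id (fun x y h => h) (fun x => idm (val_at x)) _).
by move=> x y h; rewrite cmp1m cmpm1.
Defined.

Definition mor_comp F G H (g : datum_mor G H) (f : datum_mor F G) :
  datum_mor F H.
Proof.
refine (@DatumMor F H (fun x => dmap g (dmap f x))
  (fun x y h => dmapM g (dmapM f h))
  (fun x => sharp f x ∘ sharp g (dmap f x)) _).
by move=> x y h; rewrite cmpA sharpM -cmpA sharpM cmpA.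
Defined.

Lemma mor_comp1m F G (f : datum_mor F G) : mor_comp (mor_id G) f = f.
Proof.
by apply: mor_eq => //; exists (fun x => lexx _) => x /=; rewrite res1 !cmpm1.
Qed.

Lemma mor_compm1 F G (f : datum_mor F G) : mor_comp f (mor_id F) = f.
Proof.
apply: mor_eq => //; exists (fun x => lexx _) => x /=.
by rewrite res1 cmpm1 cmp1m.
Qed.

Lemma mor_compA F G H K (h : datum_mor H K) (g : datum_mor G H)
  (f : datum_mor F G) : mor_comp h (mor_comp g f) = mor_comp (mor_comp h g) f.
Proof.
apply: mor_eq => //; exists (fun x => lexx _) => x /=.
by rewrite res1 cmpm1 cmpA.
Qed.

Definition data : category :=
  Category mor_comp1m mor_compm1 mor_compA.

Lemma mor_comp_le F G H (g g' : datum_mor G H) (f f' : datum_mor F G) :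
  mor_le g g' -> mor_le f f' -> mor_le (mor_comp g f) (mor_comp g' f').
Proof.
move=> [b gb] [a fa].
exists (fun x => le_trans (b (dmap f x)) (dmapM g' (a x))) => x /=.
rewrite -(resM (b (dmap f x)) (dmapM g' (a x))) -fa -gb.
by rewrite !cmpA; congr (_ ∘ _); rewrite -!cmpA -sharpM.
Qed.

Definition hom_poset (F G : data) : poset :=
  @Poset (datum_mor F G) (@mor_le F G) (@mor_le_refl F G)
    (@mor_le_trans F G) (@mor_le_anti F G).

Definition hom_cat (F G : data) : category := poset_cat (hom_poset F G).

Definition hom_functor (F F' G G' : data) (f : hom F' F) (g : hom G G') :
  functor (hom_cat F G) (hom_cat F' G') :=
  @poset_functor (hom_poset F G) (hom_poset F' G')
    (fun h => mor_comp g (mor_comp h f))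
    (fun h h' hh' => mor_comp_le (mor_le_refl g)
                       (mor_comp_le hh' (mor_le_refl f))).

End Data.

Arguments val_at {C F} x.
Arguments res {C F x y} h.

Definition op_data (C : category) : category := data (op (data C)).

Section OpData.
Variable C : category.

(* Arrows of op (data C) reverse direction: the restriction of X along p <= q
   is a morphism of data from X(q) to X(p), and the components of a morphism
   X -> X' go from X(p) to X'(phi p). *)
Definition piece (X : op_data C) (p : dposet X) : data C := @val_at (op (data C)) X p.

Definition trans_mor (X : op_data C) (p q : dposet X) (h : p <= q) :
  datum_mor (piece q) (piece p) := @res (op (data C)) X p q h.

Definition mor_at (X X' : op_data C) (phi : hom X X') (p : dposet X) :
  datum_mor (piece p) (piece (dmap phi p)) := sharp phi p.

Lemma trans_mor1 (X : op_data C) (p : dposet X) (h : p <= p) :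
  trans_mor h = mor_id (piece p).
Proof. exact: (@res1 (op (data C)) X p h). Qed.

Lemma trans_morM (X : op_data C) (p q r : dposet X) (h : p <= q) (k : q <= r)
  (l : p <= r) : mor_comp (trans_mor h) (trans_mor k) = trans_mor l.
Proof. exact: (@resM (op (data C)) X p q r h k l). Qed.

Lemma mor_atM (X X' : op_data C) (phi : hom X X') (p q : dposet X)
    (h : p <= q) :
  mor_comp (mor_at phi p) (trans_mor h)
  = mor_comp (trans_mor (dmapM phi h)) (mor_at phi q).
Proof. exact: (@sharpM (op (data C)) X X' phi p q h). Qed.

End OpData.

Section Lax.
Variable C : category.

(* Y stands for the datum on the one-point poset with value Y, so the lax
   naturality square has the identity of Y on one side. *)
Record lax_mor (X : op_data C) (Y : data C) := LaxMor {
  lax_at :> forall p : dposet X, datum_mor (piece p) Y;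
  lax_atP : forall (p q : dposet X) (h : p <= q),
    mor_le (mor_comp (lax_at p) (trans_mor h)) (lax_at q)
}.

Definition lax_le X Y (f g : lax_mor X Y) : Prop := forall p, mor_le (f p) (g p).

Lemma lax_le_refl X Y (f : lax_mor X Y) : lax_le f f.
Proof. by move=> p; exact: mor_le_refl. Qed.

Lemma lax_le_trans X Y (f g h : lax_mor X Y) :
  lax_le f g -> lax_le g h -> lax_le f h.
Proof. by move=> fg gh p; exact: mor_le_trans (fg p) (gh p). Qed.

Lemma lax_le_anti X Y (f g : lax_mor X Y) : lax_le f g -> lax_le g f -> f = g.
Proof.
case: f g => [f fP] [g gP] fg gf.
have E : f = g.
  apply: functional_extensionality_dep => p.
  exact: mor_le_anti (fg p) (gf p).
by case: g / E gP fg gf => gP _ _; congr LaxMor; exact: proof_irrelevance.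
Qed.

Definition lax_poset (X : op_data C) (Y : data C) : poset :=
  @Poset (lax_mor X Y) (@lax_le X Y) (@lax_le_refl X Y)
    (@lax_le_trans X Y) (@lax_le_anti X Y).

Definition lax_cat (X : op_data C) (Y : data C) : category :=
  poset_cat (lax_poset X Y).

Definition lax_whisker (X X' : op_data C) (Y Y' : data C) (phi : hom X' X)
    (g : hom Y Y') (f : lax_mor X Y) : lax_mor X' Y'.
Proof.
refine (@LaxMor X' Y'
  (fun p => mor_comp g (mor_comp (f (dmap phi p)) (mor_at phi p))) _).
move=> p q h; rewrite -!mor_compA mor_atM.
apply: mor_comp_le; first exact: mor_le_refl.
rewrite mor_compA; apply: mor_comp_le; last exact: mor_le_refl.
exact: lax_atP.
Defined.

Definition lax_functor (X X' : op_data C) (Y Y' : data C) (phi : hom X' X)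
    (g : hom Y Y') : functor (lax_cat X Y) (lax_cat X' Y') :=
  @poset_functor (lax_poset X Y) (lax_poset X' Y') (lax_whisker phi g)
    (fun f f' ff' p => mor_comp_le (mor_le_refl g)
                         (mor_comp_le (ff' (dmap phi p)) (mor_le_refl _))).

End Lax.

Section Cylinder.
Variable C : category.

Definition cyl_set (X : op_data C) : Type := {p : dposet X & dposet (piece p)}.
HB.instance Definition _ (X : op_data C) :=
  Finite.copy (cyl_set X) {p : dposet X & dposet (piece p)}.

Section Object.
Variable X : op_data C.

(* The clause x_p <= X_pq y_q only makes sense given a proof of p <= q; see
   cyl_leP. *)
Definition cyl_le (u v : cyl_set X) : bool :=
  match @idP (tag u <= tag v) with
  | ReflectT h => tagged u <= dmap (trans_mor h) (tagged v)
  | ReflectF _ => false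
  end.

Lemma cyl_leP u v :
  reflect (exists h : tag u <= tag v, tagged u <= dmap (trans_mor h) (tagged v))
          (cyl_le u v).
Proof.
rewrite /cyl_le; case: {-}_ / idP => [h|nh]; last by constructor; case.
apply: (iffP idP) => [le_uv|[h']]; first by exists h.
by rewrite (bool_irrelevance h' h).
Qed.

Lemma cyl_le_refl : reflexive cyl_le.
Proof. by move=> u; apply/cyl_leP; exists (lexx _); rewrite trans_mor1. Qed.

Lemma cyl_le_anti : antisymmetric cyl_le.
Proof.
move=> [p x] [q y] /andP[/cyl_leP[/= h xy] /cyl_leP[/= k yx]].
have E : p = q by apply: le_anti; rewrite h k.
case: q / E y h k xy yx => y h k; rewrite !trans_mor1 /= => xy yx.
by congr existT; apply: le_anti; rewrite xy yx.
Qed.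

Lemma cyl_le_trans : transitive cyl_le.
Proof.
move=> v u w /cyl_leP[h uv] /cyl_leP[k vw]; apply/cyl_leP.
exists (le_trans h k); rewrite -(trans_morM h k) /=.
exact: le_trans uv (dmapM _ vw).
Qed.

End Object.

HB.instance Definition _ (X : op_data C) :=
  Order.Le_isPOrder.Build data_display (cyl_set X)
    (@cyl_le_refl X) (@cyl_le_anti X) (@cyl_le_trans X).

Definition cyl_poset (X : op_data C) : finposet := cyl_set X.

Section Functor.
Variable X : op_data C.
Implicit Types u v w : cyl_poset X.

Lemma cyl_le_tag u v : u <= v -> tag u <= tag v.
Proof. by case/cyl_leP. Qed.

Lemma cyl_le_tagged u v (h : u <= v) :
  tagged u <= dmap (trans_mor (cyl_le_tag h)) (tagged v).
Proof.
by case/cyl_leP: (h) => k; rewrite (bool_irrelevance k (cyl_le_tag h)).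
Qed.

Definition cyl_val u : C := val_at (tagged u).

Definition cyl_res u v (h : u <= v) : hom (cyl_val u) (cyl_val v) :=
  sharp (trans_mor (cyl_le_tag h)) (tagged v) ∘ res (cyl_le_tagged h).

Lemma cyl_res1 u : cyl_res (lexx u) = idm (cyl_val u).
Proof.
rewrite /cyl_res; move: (cyl_le_tagged _); rewrite trans_mor1 /= => h.
by rewrite res1 cmpm1.
Qed.

Lemma cyl_resM u v w (k : v <= w) (h : u <= v) :
  cyl_res (le_trans h k) = cyl_res k ∘ cyl_res h.
Proof.
rewrite /cyl_res; move: (cyl_le_tagged (le_trans h k)).
rewrite -(trans_morM (cyl_le_tag h) (cyl_le_tag k)) /= => l.
rewrite -!cmpA; congr (_ ∘ _); rewrite cmpA sharpM -cmpA; congr (_ ∘ _).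
by rewrite (resM _ _ l).
Qed.

Definition cyl_obj : data C :=
  @Datum C (cyl_poset X)
    (@Functor (finposet_cat (cyl_poset X)) C cyl_val cyl_res cyl_res1
       (fun u v w k h => cyl_resM k h)).

End Functor.

Section Morphism.
Variables (X X' : op_data C) (phi : hom X X').

Definition cyl_map (u : cyl_poset X) : cyl_poset X' :=
  existT (fun p => dposet (piece p)) (dmap phi (tag u))
         (dmap (mor_at phi (tag u)) (tagged u)).

Lemma cyl_mapM (u v : cyl_poset X) : u <= v -> cyl_map u <= cyl_map v.
Proof.
move=> /cyl_leP[h uv]; apply/cyl_leP; exists (dmapM phi h) => /=.
have /(f_equal (fun m => dmap m (tagged v))) /= <- := mor_atM phi h.
exact: dmapM.
Qed.

Lemma cyl_sharpM (u v : dposet (cyl_obj X)) (h : u <= v) :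
  res h ∘ sharp (mor_at phi (tag u)) (tagged u)
  = sharp (mor_at phi (tag v)) (tagged v)
    ∘ @res _ (cyl_obj X') (cyl_map u) (cyl_map v) (cyl_mapM h).
Proof.
pose t := trans_mor (cyl_le_tag h).
pose Q (m : datum_mor (piece (tag v)) (piece (dmap phi (tag u)))) :=
  forall l : dmap (mor_at phi (tag u)) (tagged u) <= dmap m (tagged v),
    sharp t (tagged v) ∘ res (cyl_le_tagged h)
      ∘ sharp (mor_at phi (tag u)) (tagged u) = sharp m (tagged v) ∘ res l.
have : Q (mor_comp (mor_at phi (tag u)) t).
  move=> l /=; rewrite -!cmpA sharpM; congr (_ ∘ (_ ∘ res _)).
  exact: bool_irrelevance.
rewrite mor_atM (bool_irrelevance (dmapM phi _) (cyl_le_tag (cyl_mapM h))).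
by move=> /(_ (cyl_le_tagged (cyl_mapM h))) Qm; rewrite [LHS]Qm -cmpA.
Qed.

Definition cyl_mor : datum_mor (cyl_obj X) (cyl_obj X') :=
  @DatumMor C (cyl_obj X) (cyl_obj X') cyl_map cyl_mapM
    (fun u => sharp (mor_at phi (tag u)) (tagged u)) cyl_sharpM.

End Morphism.

Lemma cyl_mor1 (X : op_data C) : cyl_mor (idm X) = idm (cyl_obj X).
Proof.
apply: mor_eq => [[p x] //|].
unshelve eexists; first by case=> p x; exact: lexx.
by case=> p x; rewrite (@res1 C (cyl_obj X)) cmpm1.
Qed.

Lemma cyl_morM (X X' X'' : op_data C) (psi : hom X' X'') (phi : hom X X') :
  cyl_mor (psi ∘ phi) = (cyl_mor psi : hom (cyl_obj X') (cyl_obj X'')) ∘ cyl_mor phi.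
Proof.
apply: mor_eq => //; exists (fun u => lexx _) => u.
by rewrite (@res1 C (cyl_obj X'')) cmpm1.
Qed.

Definition Cyl : functor (op_data C) (data C) :=
  @Functor (op_data C) (data C) cyl_obj (fun X X' phi => cyl_mor phi)
    cyl_mor1 (fun X X' X'' psi phi => cyl_morM psi phi).

End Cylinder.

Definition is_lax_colimit (C : category) (X : op_data C) (L : data C) : Prop :=
  exists Phi : forall Y : data C, cat_iso (hom_cat L Y) (lax_cat X Y),
  forall (Y Y' : data C) (g : hom Y Y'),
    functor_comp (Phi Y') (hom_functor (idm L) g)
    = functor_comp (lax_functor (idm X) g) (Phi Y).

Definition is_lax_colimit_functor (C : category)
    (L : functor (op_data C) (data C)) : Prop :=
  exists Phi : forall (X : op_data C) (Y : data C),
    cat_iso (hom_cat (L X) Y) (lax_cat X Y),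
  forall (X X' : op_data C) (Y Y' : data C) (phi : hom X' X) (g : hom Y Y'),
    functor_comp (Phi X' Y') (hom_functor (fmap L phi) g)
    = functor_comp (lax_functor phi g) (Phi X Y).

(* Main.v *)
From mathcomp Require Import all_boot all_order.
From Stdlib Require Import FunctionalExtensionality ProofIrrelevance.
Require Import Defs.

(* The inclusions i_p : X(p) -> Cyl X form a lax cocone, since (p, X_pq y) is
   below (q, y) in Cyl X, with restriction morphism the component of X_pq at y.
   Precomposition with this cocone sends f : Cyl X -> Y to the family of the
   f i_p; conversely a lax family glues to a morphism on Cyl X, the lax
   inequalities being exactly what is needed for monotonicity and for
   compatibility with restrictions across distinct pieces.  Naturality in X
   comes from Cyl(phi) i_p = i_(phi p) phi_p.  Uniqueness of the lax colimit
   functor is the Yoneda lemma: identities are transported along the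
   isomorphisms of hom-categories. *)

Set Implicit Arguments.
Unset Strict Implicit.
Unset Printing Implicit Defensive.
Import Order.TTheory.
Local Open Scope order_scope.
Local Open Scope cat_scope.

(** * Functors into posets and isomorphisms of categories *)

(** Arrows of [poset_cat Q] are proofs, so only the action on objects carries information. *)
Lemma functor_to_poset_eq (A : category) (Q : poset)
    (F G : functor A (poset_cat Q)) : (forall a, F a = G a) -> F = G.
Proof.
case: F G => [F Fm F1 FM] [G Gm G1 GM] /= /functional_extensionality FG.
case: G / FG Gm G1 GM => Gm G1 GM.
have E : Fm = Gm.
  apply: functional_extensionality_dep => a.
  apply: functional_extensionality_dep => b.
  apply: functional_extensionality => h.
  exact: (@proof_irrelevance (@ple Q (F a) (F b))).
by case: Gm / E G1 GM => G1 GM; congr Functor; exact: proof_irrelevance.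
Qed.

Lemma fobj_eq (A B : category) (F G : functor A B) : F = G -> F =1 G.
Proof. by move->. Qed.

Lemma cat_iso_funK (A B : category) (Phi : cat_iso A B) :
  cancel Phi (iso_inv Phi).
Proof. by move=> a; exact: (fobj_eq (iso_funK Phi) a). Qed.

Lemma cat_iso_invK (A B : category) (Phi : cat_iso A B) :
  cancel (iso_inv Phi) Phi.
Proof. by move=> b; exact: (fobj_eq (iso_invK Phi) b). Qed.

Section Representation.
Variable C : category.

(** * The lax cocone of inclusions *)

Section Inclusion.
Variable X : op_data C.

Definition cyl_pair (p : dposet X) (x : dposet (piece p)) : cyl_poset X :=
  existT (fun p => dposet (piece p)) p x.

Lemma cyl_pair_le (p : dposet X) (x y : dposet (piece p)) :
  x <= y -> cyl_pair x <= cyl_pair y.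
Proof. by move=> xy; apply/cyl_leP; exists (lexx _); rewrite trans_mor1. Qed.

Lemma cyl_pair_res (p : dposet X) (x y : dposet (piece p)) (h : x <= y) :
  @res C (cyl_obj X) _ _ (cyl_pair_le h) = res h.
Proof.
(* The inequality proof is generalized because its type mentions the transition morphism that
   [trans_mor1] rewrites to an identity. *)
rewrite [LHS]/(cyl_res _) /cyl_res; move: (cyl_le_tagged _).
by rewrite trans_mor1 /= => l; rewrite cmp1m (bool_irrelevance l h).
Qed.

Lemma cyl_incl_sharpM (p : dposet X) (x y : dposet (piece p)) (h : x <= y) :
  res h ∘ idm (val_at x)
  = idm (val_at y) ∘ @res C (cyl_obj X) _ _ (cyl_pair_le h).
Proof. by rewrite cyl_pair_res cmp1m cmpm1. Qed.

Definition cyl_incl (p : dposet X) : datum_mor (piece p) (cyl_obj X) :=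
  @DatumMor C (piece p) (cyl_obj X) (@cyl_pair p) (@cyl_pair_le p)
    (fun x => idm (val_at x)) (@cyl_incl_sharpM p).

Lemma cyl_incl_lax (p q : dposet X) (h : p <= q) :
  mor_le (mor_comp (cyl_incl p) (trans_mor h)) (cyl_incl q).
Proof.
have le_incl y : cyl_pair (dmap (trans_mor h) y) <= cyl_pair y.
  by apply/cyl_leP; exists h.
exists le_incl => y /=; rewrite cmp1m cmpm1 [LHS]/(cyl_res _) /cyl_res.
move: (cyl_le_tagged _).
(* After this, [l] is a reflexive inequality and only the sharp component of X_pq remains. *)
have -> : cyl_le_tag (le_incl y) = h by exact: bool_irrelevance.
by move=> l; rewrite /= res1 cmpm1.
Qed.

End Inclusion.

Lemma cyl_mor_incl (X X' : op_data C) (phi : hom X X') (p : dposet X) :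
  mor_comp (cyl_mor phi) (cyl_incl p)
  = mor_comp (cyl_incl (dmap phi p)) (mor_at phi p).
Proof.
apply: mor_eq => //; exists (fun x => lexx _) => x.
by rewrite (@res1 C (cyl_obj X')) cmpm1 /= cmp1m cmpm1.
Qed.

(** * Restriction to the pieces and gluing *)

Section Isomorphism.
Variables (X : op_data C) (Y : data C).

Lemma cyl_restrict_lax (f : datum_mor (cyl_obj X) Y) (p q : dposet X)
    (h : p <= q) :
  mor_le (mor_comp (mor_comp f (cyl_incl p)) (trans_mor h))
         (mor_comp f (cyl_incl q)).
Proof.
rewrite -mor_compA; apply: mor_comp_le; first exact: mor_le_refl.
exact: cyl_incl_lax.
Qed.

Definition cyl_restrict (f : datum_mor (cyl_obj X) Y) : lax_mor X Y :=
  LaxMor (cyl_restrict_lax f).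

Lemma cyl_restrict_le (f g : datum_mor (cyl_obj X) Y) :
  mor_le f g -> lax_le (cyl_restrict f) (cyl_restrict g).
Proof. by move=> fg p; apply: mor_comp_le => //; exact: mor_le_refl. Qed.

Section Glue.
Variable f : lax_mor X Y.

Definition cyl_glue_map (u : cyl_poset X) : dposet Y :=
  dmap (f (tag u)) (tagged u).

Lemma lax_map_le (p q : dposet X) (h : p <= q) (y : dposet (piece q)) :
  dmap (f p) (dmap (trans_mor h) y) <= dmap (f q) y.
Proof. by have [le_f _] := lax_atP f h; exact: le_f. Qed.

(** The equational half of the lax inequality, over the fixed proof [lax_map_le] so that it can be
    used for rewriting. *)
Lemma lax_sharp (p q : dposet X) (h : p <= q) (y : dposet (piece q)) :
  sharp (f q) y ∘ res (lax_map_le h y)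
  = sharp (trans_mor h) y ∘ sharp (f p) (dmap (trans_mor h) y).
Proof.
have [le_f fE] := lax_atP f h; rewrite -[RHS](fE y).
by congr (_ ∘ res _); exact: bool_irrelevance.
Qed.

Lemma cyl_glue_mapM (u v : cyl_poset X) :
  u <= v -> cyl_glue_map u <= cyl_glue_map v.
Proof.
move=> uv; apply: le_trans (lax_map_le (cyl_le_tag uv) (tagged v)).
exact/dmapM/cyl_le_tagged.
Qed.

Lemma cyl_glue_sharpM (u v : dposet (cyl_obj X)) (h : u <= v) :
  res h ∘ sharp (f (tag u)) (tagged u)
  = sharp (f (tag v)) (tagged v)
    ∘ @res _ Y (cyl_glue_map u) (cyl_glue_map v) (cyl_glue_mapM h).
Proof.
(* Naturality of f_p passes the restriction inside X(p), the lax equation absorbs the sharp map of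
   X_pq, and the two resulting restrictions of Y merge. *)
rewrite [res h]/(cyl_res _) /cyl_res -cmpA sharpM cmpA -lax_sharp -cmpA.
by rewrite (resM _ _ (cyl_glue_mapM h)).
Qed.

Definition cyl_glue : datum_mor (cyl_obj X) Y :=
  @DatumMor C (cyl_obj X) Y cyl_glue_map cyl_glue_mapM
    (fun u => sharp (f (tag u)) (tagged u)) cyl_glue_sharpM.

End Glue.

Lemma cyl_glue_le (f g : lax_mor X Y) :
  lax_le f g -> mor_le (cyl_glue f) (cyl_glue g).
Proof.
move=> fg.
have le_fg u : cyl_glue_map f u <= cyl_glue_map g u.
  by have [le_fg _] := fg (tag u); exact: le_fg.
exists le_fg => u; have [le_u fgE] := fg (tag u).
rewrite -[RHS](fgE (tagged u)) /=.
by congr (_ ∘ res _); exact: bool_irrelevance.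
Qed.

Lemma cyl_restrictK : cancel cyl_restrict cyl_glue.
Proof.
move=> f; apply: mor_eq => [[p x] //|].
(* A point reduces to the pair of its [tag] and [tagged] only once destructed, so even the
   inequality is proved by cases. *)
unshelve eexists; first by case=> p x; exact: lexx.
by case=> p x; rewrite res1 cmpm1 /= cmp1m.
Qed.

Lemma cyl_glueK : cancel cyl_glue cyl_restrict.
Proof.
move=> f; apply: lax_le_anti => p; exists (fun x => lexx _) => x.
  by rewrite res1 cmpm1 /= cmp1m.
by rewrite res1 cmpm1 /= cmp1m.
Qed.

(** Kept transparent: naturality is checked by computing with [cyl_restrict]. *)
Definition cyl_iso : cat_iso (hom_cat (Cyl C X) Y) (lax_cat X Y).
Proof.
refine (@CatIso (hom_cat (Cyl C X) Y) (lax_cat X Y)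
  (@poset_functor (hom_poset (Cyl C X) Y) (lax_poset X Y)
     cyl_restrict cyl_restrict_le)
  (@poset_functor (lax_poset X Y) (hom_poset (Cyl C X) Y)
     cyl_glue cyl_glue_le) _ _); apply: functor_to_poset_eq.
- exact: cyl_restrictK.
- exact: cyl_glueK.
Defined.

End Isomorphism.

Lemma cyl_iso_nat (X X' : op_data C) (Y Y' : data C) (phi : hom X' X)
    (g : hom Y Y') :
  functor_comp (cyl_iso X' Y') (hom_functor (fmap (Cyl C) phi) g)
  = functor_comp (lax_functor phi g) (cyl_iso X Y).
Proof.
apply: functor_to_poset_eq => f; apply: lax_le_anti => p /=;
  rewrite -!mor_compA cyl_mor_incl; exact: mor_le_refl.
Qed.

(** * Lax colimit functors and their uniqueness *)

Lemma Cyl_lax_colimit_functor : is_lax_colimit_functor (Cyl C).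
Proof. by exists cyl_iso; exact: cyl_iso_nat. Qed.

Lemma lax_colimit_functor_colimit (L : functor (op_data C) (data C)) :
  is_lax_colimit_functor L -> forall X, is_lax_colimit X (L X).
Proof.
move=> [Phi PhiN] X; exists (Phi X) => Y Y' g.
by rewrite -PhiN fmap1.
Qed.

(** The condition under the existential of [is_lax_colimit_functor], isolated because the comparison
    morphisms are built from a chosen [Phi]. *)
Definition lax_representation (L : functor (op_data C) (data C))
    (Phi : forall (X : op_data C) (Y : data C),
       cat_iso (hom_cat (L X) Y) (lax_cat X Y)) : Prop :=
  forall (X X' : op_data C) (Y Y' : data C) (phi : hom X' X) (g : hom Y Y'),
    functor_comp (Phi X' Y') (hom_functor (fmap L phi) g)
    = functor_comp (lax_functor phi g) (Phi X Y).

Section Comparison.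
Variables (L : functor (op_data C) (data C)).
Variable Phi : forall (X : op_data C) (Y : data C),
  cat_iso (hom_cat (L X) Y) (lax_cat X Y).
Hypothesis PhiN : lax_representation Phi.

Lemma representation_post (X : op_data C) (Y Y' : data C)
    (g : hom Y Y') (h : hom (L X) Y) :
  Phi X Y' (g ∘ h) = lax_whisker (idm X) g (Phi X Y h).
Proof.
(* An identity is inserted and read as the image under L of [idm X], so that naturality in both
   variables applies. *)
rewrite -[g ∘ h]cmpm1 -cmpA -(fmap1 L X).
exact: (fobj_eq (PhiN (idm X) g) h).
Qed.

Lemma representation_pre (X X' : op_data C) (Y : data C) (phi : hom X' X)
    (h : hom (L X) Y) :
  Phi X' Y (h ∘ fmap L phi) = lax_whisker phi (idm Y) (Phi X Y h).
Proof.
rewrite -[h ∘ _]cmp1m.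
exact: (fobj_eq (PhiN phi (idm Y)) h).
Qed.

End Comparison.

Section Uniqueness.
Variables (L M : functor (op_data C) (data C)).
Variable Phi : forall (X : op_data C) (Y : data C),
  cat_iso (hom_cat (L X) Y) (lax_cat X Y).
Variable Psi : forall (X : op_data C) (Y : data C),
  cat_iso (hom_cat (M X) Y) (lax_cat X Y).
Hypothesis PhiN : lax_representation Phi.
Hypothesis PsiN : lax_representation Psi.

(** The Yoneda morphism: [Phi] sends it to the universal lax cocone on M X. *)
Definition comparison (X : op_data C) : hom (L X) (M X) :=
  iso_inv (Phi X (M X)) (Psi X (M X) (idm (M X))).

(** Both sides are natural in Y, so agreement at the identity of M X propagates to every h. *)
Lemma comparison_comp (X : op_data C) (Y : data C) (h : hom (M X) Y) :
  Phi X Y (h ∘ comparison X) = Psi X Y h.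
Proof.
rewrite (representation_post PhiN) cat_iso_invK.
by rewrite -(representation_post PsiN) cmpm1.
Qed.

Lemma comparison_nat (X X' : op_data C) (phi : hom X X') :
  fmap M phi ∘ comparison X = comparison X' ∘ fmap L phi.
Proof.
(* Under [Phi] both sides become the image by [Psi] of [fmap M phi]. *)
apply: (can_inj (cat_iso_funK (Phi X (M X')))).
rewrite comparison_comp (representation_pre PhiN) cat_iso_invK.
by rewrite -(representation_pre PsiN) cmp1m.
Qed.

End Uniqueness.

(** Stated for arbitrary L and M so that exchanging them gives the other composite. *)
Lemma comparisonK (L M : functor (op_data C) (data C)) Phi Psi
    (PhiN : @lax_representation L Phi) (PsiN : @lax_representation M Psi) X :
  comparison Psi Phi X ∘ comparison Phi Psi X = idm (L X).
Proof.
apply: (can_inj (cat_iso_funK (Phi X (L X)))).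
by rewrite (comparison_comp PhiN PsiN) cat_iso_invK.
Qed.

Lemma lax_colimit_functor_unique (L M : functor (op_data C) (data C)) :
  is_lax_colimit_functor L -> is_lax_colimit_functor M -> nat_isomorphic L M.
Proof.
move=> [Phi PhiN] [Psi PsiN].
exists (NatTrans (comparison_nat PhiN PsiN)) => X.
by exists (comparison Psi Phi X); split; exact: comparisonK.
Qed.

End Representation.

Theorem proposition5p3 (C : category) :
  (forall X : op_data C, is_lax_colimit X (Cyl C X)) /\
  (exists Phi : forall (X : op_data C) (Y : data C),
      cat_iso (hom_cat (Cyl C X) Y) (lax_cat X Y),
    forall (X X' : op_data C) (Y Y' : data C) (phi : hom X' X) (g : hom Y Y'),
      functor_comp (Phi X' Y') (hom_functor (fmap (Cyl C) phi) g)
      = functor_comp (lax_functor phi g) (Phi X Y)) /\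
  (forall L : functor (op_data C) (data C),
    is_lax_colimit_functor L -> nat_isomorphic (Cyl C) L).
Proof.
split; first exact: lax_colimit_functor_colimit (Cyl_lax_colimit_functor C).
split; first exact: Cyl_lax_colimit_functor.
by move=> L; exact: lax_colimit_functor_unique (Cyl_lax_colimit_functor C).
Qed.
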